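(* Let $m\in\mathbb{N}$ and let $\mathscr{C}$ be a class of graphs, each of doubling dimension at most $m$. Then for any $r\in\mathbb{N}_{>0}$ the following conditions are equivalent: (1) There exist $k_1,\Delta_1\in\mathbb{N}$ such that every member of $\mathscr{C}$ has a tree-partition of spread $r$, maximum degree at most $\Delta_1$, and with $(k_1,r)$-coverable bags. (2) There exists $k_2\in\mathbb{N}$ such that every member of $\mathscr{C}$ has a tree decomposition with $(k_2,r)$-coverable bags. (3) There exists $k_3\in\mathbb{N}$ such that every member of $\mathscr{C}$ has distance-$r$ balanced separator number at most $k_3$. (4) There exist $k_4,\Delta_4\in\mathbb{N}$ such that every member of $\mathscr{C}$ is $(3,3r)$-quasi-isometric with an edge-weighted graph of tree-partition width at most $k_4$, maximum degree at most $\Delta_4$, and every edge of weight $3r$. (5) There exist $k_5,\Delta_5\in\mathbb{N}$ and $\alpha,\beta,\gamma\in\mathbb{R}_{>0}$ such that every member of $\mathscr{C}$ is $(\alpha,\beta r)$-quasi-isometric with an edge-weighted graph of tree-partition width at most $k_5$, maximum degree at most $\Delta_5$, and every edge of weight at least $\gamma r$. Moreover, the constants $k_1,k_2,k_3,k_4,k_5,\Delta_1,\Delta_4,\Delta_5,\alpha,\beta,\gamma$ can be bounded by functions of each other and of $m$, independent of $r$.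
   Context: All graphs are finite and simple; unless said otherwise they are unweighted and distances are shortest-path distances $\mathrm{dist}_G$. In an edge-weighted graph (edge weights in $\mathbb{R}_{\geq 0}$) the length of a path is the sum of its edge weights. $\mathrm{Ball}_G(u,r)=\{v:\mathrm{dist}_G(u,v)\le r\}$. A vertex set $A$ of $G$ is $(k,r)$-coverable if there are $k$ radius-$r$ balls in $G$ (distances measured in $G$) whose union contains $A$. A graph $G$ has doubling dimension at most $m$ if for every real $r\ge 0$ every radius-$2r$ ball of $G$ can be covered by $2^m$ radius-$r$ balls. For a weight function $\mu:V(G)\to\mathbb{R}_{\ge0}$, a set $X\subseteq V(G)$ is a balanced separator for $\mu$ if every connected component $C$ of $G-X$ satisfies $\mu(V(C))\le\frac12\mu(V(G))$. The distance-$r$ balanced separator number of $G$ is the smallest $k$ such that every weight function $\mu$ admits a $(k,r)$-coverable balanced separator. A tree-partition of $G$ is a pair $(T,\mathsf{bag})$ with $T$ a tree and $\mathsf{bag}:V(T)\to 2^{V(G)}$ such that the bags partition $V(G)$ and for every edge $uv$ of $G$, either $u,v$ lie in a common bag or in bags of adjacent nodes of $T$. Its width is the largest bag size; the tree-partition width of a graph is the minimum width of a tree-partition; its maximum degree is the maximum degree of $T$. A tree-partition has spread $r$ if for every pair $u,v$ with $\mathrm{dist}_G(u,v)\le r$, $u,v$ lie in a common bag or in bags of adjacent nodes of $T$. For $\alpha\ge1,\beta\ge0$, $G$ is $(\alpha,\beta)$-quasi-isometric with $H$ if there is a map $\varphi:V(G)\to V(H)$ with $\frac1\alpha\mathrm{dist}_G(u,v)-\beta\le\mathrm{dist}_H(\varphi(u),\varphi(v))\le\alpha\,\mathrm{dist}_G(u,v)+\beta$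 for all $u,v$, and every $w\in V(H)$ is at $H$-distance at most $\beta$ from some $\varphi(u)$. *)

(* Defs.v *)
From HB Require Import structures.
From mathcomp Require Import all_boot all_order all_algebra.
From mathcomp Require Import boolp classical_sets reals ereal.

Set Implicit Arguments.
Unset Strict Implicit.
Unset Printing Implicit Defensive.

Import Order.TTheory GRing.Theory Num.Theory.
Local Open Scope ring_scope.

Record sgraph := SGraph {
  vertex :> finType;
  edge : rel vertex;
  edge_sym : symmetric edge;
  edge_irrefl : irreflexive edge }.

Definition graph_class := sgraph -> Prop.

Definition max_degree (G : sgraph) : nat :=
  \max_(x : G) #|[set y | edge x y]|.

(* Weights are functions of two vertices; values off the edges play no role. *)
Record wgraph (R : realType) := WGraph {
  wg_graph :> sgraph;
  weight : wg_graph -> wg_graph -> R;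
  weight_sym : forall x y, weight x y = weight y x;
  weight_ge0 : forall x y, 0 <= weight x y }.

Definition unit_weighted (R : realType) (G : sgraph) : wgraph R :=
  @WGraph R G (fun _ _ => 1) (fun _ _ => erefl) (fun _ _ => ler01).

(* Length of the walk x :: p. *)
Fixpoint walk_length (R : realType) (H : wgraph R) (x : H) (p : seq H) : R :=
  if p is y :: q then weight x y + walk_length y q else 0.

(* +oo between distinct components. Infimum over walks, which for
   nonnegative weights is the minimum over paths. *)
Definition dist (R : realType) (H : wgraph R) (u v : H) : \bar R :=
  ereal_inf [set l | exists p : seq H,
    [/\ path (@edge H) u p, last u p = v & l = (walk_length u p)%:E]].

Definition gdist (R : realType) (G : sgraph) (u v : G) : \bar R :=
  @dist R (unit_weighted R G) u v.

Definition ball (R : realType) (G : sgraph) (u : G) (rho : R) : {set G} :=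
  [set v | (gdist R u v <= rho%:E)%E].

(* "k balls" is read as "at most k balls". *)
Definition coverable (R : realType) (G : sgraph) (k : nat) (rho : R)
    (A : {set G}) : Prop :=
  exists S : {set G},
    (#|S| <= k)%N /\ A \subset \bigcup_(s in S) ball s rho.

Definition doubling_dim_le (R : realType) (m : nat) (G : sgraph) : Prop :=
  forall (rho : R) (u : G), 0 <= rho ->
    coverable (2 ^ m)%N rho (ball u (2 * rho)).

Definition component_avoiding (G : sgraph) (X : {set G}) (x : G) : {set G} :=
  [set y | connect [rel a b | [&& edge a b, a \notin X & b \notin X]] x y].

Definition balanced_separator (R : realType) (G : sgraph) (mu : G -> R)
    (X : {set G}) : Prop :=
  forall x : G, x \notin X ->
    \sum_(y in component_avoiding X x) mu y <= 2^-1 * \sum_(y : G) mu y.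

Definition separable (R : realType) (G : sgraph) (r k : nat) : Prop :=
  forall mu : G -> R, (forall x, 0 <= mu x) ->
    exists X : {set G}, balanced_separator mu X /\ coverable k (r%:R : R) X.

Lemma gdist_refl_le0 (R : realType) (G : sgraph) (u : G) :
  (gdist R u u <= 0)%E.
Proof. by apply: ereal_inf_lbound; exists [::]. Qed.

Lemma separable_exists (R : realType) (G : sgraph) (r : nat) :
  exists k, `[< separable R G r k >].
Proof.
exists #|G|; apply/asboolP => mu _; exists [set: G]%SET; split.
  by move=> x; rewrite finset.in_setT.
exists [set: G]%SET; split; first by rewrite cardsT.
apply/fintype.subsetP => x _; apply/finset.bigcupP; exists x; rewrite ?finset.in_setT // inE.
by apply: le_trans (gdist_refl_le0 R x) _; rewrite lee_fin ler0n.
Qed.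

Definition balanced_separator_number (R : realType) (r : nat) (G : sgraph) :
    nat :=
  ex_minn (separable_exists R G r).

Definition is_tree (T : sgraph) : Prop :=
  [/\ (0 < #|T|)%N,
      forall s t : T, connect (@edge T) s t
    & forall c : seq T, (2 < size c)%N -> ~ ucycle (@edge T) c].

(* Bags may be empty. *)
Definition tree_partition (G T : sgraph) (bag : T -> {set G}) : Prop :=
  [/\ is_tree T,
      forall v : G, exists! t : T, v \in bag t
    & forall u v : G, edge u v ->
        (exists t, u \in bag t /\ v \in bag t) \/
        (exists s t, [/\ edge s t, u \in bag s & v \in bag t])].

Definition has_spread (R : realType) (r : nat) (G T : sgraph)
    (bag : T -> {set G}) : Prop :=
  forall u v : G, (gdist R u v <= r%:R%:E)%E ->
    (exists t, u \in bag t /\ v \in bag t) \/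
    (exists s t, [/\ edge s t, u \in bag s & v \in bag t]).

Definition tp_width (G T : sgraph) (bag : T -> {set G}) : nat :=
  \max_(t : T) #|bag t|.

Definition has_tp_of_width (G : sgraph) (k : nat) : Prop :=
  exists (T : sgraph) (bag : T -> {set G}),
    tree_partition bag /\ tp_width bag = k.

Definition single_node : sgraph :=
  @SGraph unit (fun _ _ => false) (fun _ _ => erefl) (fun _ => erefl).

Lemma has_tp_of_width_exists (G : sgraph) :
  exists k, `[< has_tp_of_width G k >].
Proof.
pose bag (_ : single_node) := [set: G]%SET.
exists (tp_width bag); apply/asboolP; exists single_node, bag; split => //.
split.
- split; first by rewrite card_unit.
    by move=> [] []; exact: connect0.
  by case=> [|[] [|[] c]].
- by move=> v; exists tt; split; [rewrite finset.in_setT | case].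
- by move=> u v _; left; exists tt; rewrite !finset.in_setT.
Qed.

Definition tree_partition_width (G : sgraph) : nat :=
  ex_minn (has_tp_of_width_exists G).

Definition tree_decomposition (G T : sgraph) (bag : T -> {set G}) : Prop :=
  [/\ is_tree T,
      forall v : G, exists t, v \in bag t,
      forall u v : G, edge u v -> exists t, u \in bag t /\ v \in bag t
    & forall (v : G) (s t : T), v \in bag s -> v \in bag t ->
        connect [rel a b | [&& edge a b, v \in bag a & v \in bag b]] s t].

Definition coverable_bags (R : realType) (k r : nat) (G T : sgraph)
    (bag : T -> {set G}) : Prop :=
  forall t : T, coverable k (r%:R : R) (bag t).

Definition quasi_isometric (R : realType) (alpha beta : R) (G H : wgraph R) :
    Prop :=
  [/\ 1 <= alpha, 0 <= beta
    & exists phi : G -> H,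
      (forall u v : G,
         (alpha^-1%:E * dist u v - beta%:E <= dist (phi u) (phi v))%E /\
         (dist (phi u) (phi v) <= alpha%:E * dist u v + beta%:E)%E) /\
      (forall w : H, exists u : G, (dist w (phi u) <= beta%:E)%E)].

Definition spread_tree_partitions (R : realType) (C : graph_class)
    (r k Delta : nat) : Prop :=
  forall G, C G -> exists (T : sgraph) (bag : T -> {set G}),
    [/\ tree_partition bag, has_spread R r bag,
        (max_degree T <= Delta)%N & coverable_bags R k r bag].

Definition coverable_tree_decompositions (R : realType) (C : graph_class)
    (r k : nat) : Prop :=
  forall G, C G -> exists (T : sgraph) (bag : T -> {set G}),
    tree_decomposition bag /\ coverable_bags R k r bag.

Definition bounded_separator_number (R : realType) (C : graph_class)
    (r k : nat) : Prop :=
  forall G, C G -> (balanced_separator_number R r G <= k)%N.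

Definition quasi_isometric_3_3r (R : realType) (C : graph_class)
    (r k Delta : nat) : Prop :=
  forall G, C G -> exists H : wgraph R,
    [/\ quasi_isometric 3 (3 * r%:R) (unit_weighted R G) H,
        (tree_partition_width H <= k)%N, (max_degree H <= Delta)%N
      & forall x y : H, edge x y -> weight x y = 3 * r%:R].

Definition quasi_isometric_linear (R : realType) (C : graph_class)
    (r k Delta : nat) (alpha beta gamma : R) : Prop :=
  [/\ 0 < alpha, 0 < beta & 0 < gamma] /\
  forall G, C G -> exists H : wgraph R,
    [/\ quasi_isometric alpha (beta * r%:R) (unit_weighted R G) H,
        (tree_partition_width H <= k)%N, (max_degree H <= Delta)%N
      & forall x y : H, edge x y -> gamma * r%:R <= weight x y].

Inductive condition : Set :=
  | SpreadTreePartition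
  | CoverableTreeDecomposition
  | BoundedSeparatorNumber
  | QuasiIsometric_3_3r
  | QuasiIsometricLinear.

Definition constants (R : realType) (i : condition) : Type :=
  match i with
  | SpreadTreePartition => nat * nat
  | CoverableTreeDecomposition => nat
  | BoundedSeparatorNumber => nat
  | QuasiIsometric_3_3r => nat * nat
  | QuasiIsometricLinear => nat * nat * (R * R * R)
  end%type.

Definition holds_with (R : realType) (C : graph_class) (r : nat)
    (i : condition) : constants R i -> Prop :=
  match i return constants R i -> Prop with
  | SpreadTreePartition =>
      fun c => spread_tree_partitions R C r c.1 c.2
  | CoverableTreeDecomposition =>
      fun c => coverable_tree_decompositions R C r c
  | BoundedSeparatorNumber =>
      fun c => bounded_separator_number R C r c
  | QuasiIsometric_3_3r =>
      fun c => quasi_isometric_3_3r R C r c.1 c.2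
  | QuasiIsometricLinear =>
      fun c => quasi_isometric_linear C r c.1.1 c.1.2 c.2.1.1 c.2.1.2 c.2.2
  end.

Arguments holds_with : clear implicits.

(* Main.v *)
(** Let N be a maximal set of vertices of G at pairwise distance more than r,
    and let H be the graph on N that joins points at distance at most 3r.
    Doubling bounds the maximum degree of H, and the map sending a vertex of G
    to a nearby point of N is a (3,3r)-quasi-isometry once the edges of H get
    weight 3r.  A separator of G covered by k balls of radius r yields a
    separator of H with O(k) vertices: take the points of N within 4r of the
    centres.  Since H has bounded degree and small balanced separators, it has
    a tree-partition of bounded width and degree: carry along a small set S to
    be placed in the root bag; if S is very small, make it the root bag and
    continue with its neighbourhood; otherwise split along a separator that is
    balanced for S and glue the two roots, S having become smaller on both
    sides.  This partition proves (4), and (1) after pulling it back to G.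
    Conversely, a quasi-isometry to H as in (5) turns a tree-partition of H into
    a tree decomposition of G: put v in every bag that meets a ball of bounded
    hop radius around the image of v. *)

From mathcomp Require Import boolp classical_sets reals ereal.
From mathcomp Require Import all_boot all_order all_algebra.
From mathcomp Require Import lra zify.
Require Import Defs.

Set Implicit Arguments.
Unset Strict Implicit.
Unset Printing Implicit Defensive.

Import Order.TTheory GRing.Theory Num.Theory.

(** * Trees *)

(** A simple path from [s] to [t] other than the edge itself has at least three vertices, and the
    edge back to [s] closes it to a cycle. Deleting only the orientation from [s] to [t] makes the
    statement stronger. *)
Lemma tree_no_return (T : sgraph) (s t : T) : is_tree T -> edge s t ->
  ~~ connect [rel a b | edge a b && ~~ ((a == s) && (b == t))] s t.
Proof.
move=> [_ _ acyclic] st; apply/negP => /connectP[p pP lastp].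
case/shortenP: pP lastp => {}p pP p_uniq _ lastp.
apply: (acyclic (s :: p)).
  case: p pP p_uniq lastp => [|a [|b p]] //=.
    by move=> _ _ Et; move: st; rewrite Et edge_irrefl.
  by move=> + _ Et; rewrite Et !eqxx andbF.
rewrite /ucycle p_uniq andbT /= rcons_path -lastp edge_sym st andbT.
by apply: sub_path pP => a b /= /andP[].
Qed.

(* Iterating [f] runs into a cycle, which in a tree can only have length two. *)
Lemma tree_mutual_pointers (T : sgraph) (f : T -> T) : is_tree T ->
  (forall t, edge t (f t)) -> exists s, f (f s) = s.
Proof.
move=> [T0 _ acyclic] ef.
apply/not_existsP => nomutual.
have /card_gt0P[t _] := T0.
have /trajectP[i lti Ei] := looping_order f t.
pose s := iter i f t.
have cyc : fcycle f (traject f s (order f t - i)).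
  have : 0 < order f t - i by rewrite subn_gt0.
  have : iter (order f t - i) f s = s by rewrite /s -iterD subnK // ltnW.
  case: (order f t - i) => // n En _.
  rewrite trajectS /= rcons_path fpath_traject /= last_traject.
  by rewrite -iterS En.
have un : uniq (traject f s (order f t - i)).
  have := orbit_uniq f t; rewrite /orbit -{1}(subnKC (ltnW lti)).
  by rewrite trajectD cat_uniq => /and3P[].
apply: (acyclic (traject f s (order f t - i))); last first.
  rewrite /ucycle un andbT; apply: sub_cycle cyc => a b /= /eqP <-; exact: ef.
move: cyc un; rewrite size_traject.
have : 0 < order f t - i by rewrite subn_gt0.
(* Length one would be a loop at [s], and length two a mutual pair. *)
case: (order f t - i) => [|[|[|n]]] //= _.
- by rewrite andbT => /eqP Es; have := ef s; rewrite Es edge_irrefl.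
- by rewrite andbT => /andP[_ /eqP /(nomutual s)].
Qed.

(* The nodes of a rooted tree are [option T]: [None] is the root, and
   [parent t = None] means that [t] is a child of the root. *)
Record rooted_tree := RootedTree {
  node :> finType;
  parent : node -> option node;
  depth : node -> nat;
  depth_parent : forall s t, parent t = Some s -> depth s < depth t }.

Section RootedTree.
Variable T : rooted_tree.

Definition is_parent (p : option T) (x : option T) : bool :=
  if x is Some t then parent t == p else false.

Definition children (p : option T) : {set T} := [set t | parent t == p].

(** The shift by one puts the root strictly above its children, whatever their [depth]. *)
Definition odepth (x : option T) := if x is Some t then (depth t).+1 else 0.

Lemma odepth_parent p x : is_parent p x -> odepth p < odepth x.
Proof.
by case: x => [t|] //=; case: p => [s|] // /eqP /depth_parent.
Qed.

Definition rooted_edge (x y : option T) := is_parent x y || is_parent y x.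

Lemma rooted_edge_sym : symmetric rooted_edge.
Proof. by move=> x y; rewrite /rooted_edge orbC. Qed.

Lemma rooted_edge_irrefl : irreflexive rooted_edge.
Proof.
by move=> x; apply/negP; rewrite /rooted_edge orbb => /odepth_parent; rewrite ltnn.
Qed.

Definition rooted_graph := SGraph rooted_edge_sym rooted_edge_irrefl.

Lemma rooted_graph_is_tree : is_tree rooted_graph.
Proof.
split.
- by apply/card_gt0P; exists None.
- have sym : connect_sym (@edge rooted_graph).
    by apply: sym_connect_sym; apply: rooted_edge_sym.
  suff root (x : rooted_graph) : connect (@edge rooted_graph) x None.
    by move=> s t; apply: connect_trans (root s) _; rewrite sym.
  have [n] := ubnP (odepth x); elim: n x => // n IHn [t|] ltn; last exact: connect0.
  have pt : is_parent (parent t) (Some t) by rewrite /= eqxx.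
  apply: (@connect_trans _ _ (parent t : rooted_graph)).
    by apply: connect1; rewrite /edge /= /rooted_edge pt orbT.
  by apply: IHn; apply: leq_trans (odepth_parent pt) _.
- move=> c c3 /andP[cyc uniq_c].
  have [x0 x0c] : exists x0, x0 \in c.
    by case: c c3 {cyc uniq_c} => // x0 c _; exists x0; rewrite mem_head.
  (* Both cyclic neighbours of a deepest node of the cycle would be its parent. *)
  have [x xc xmax] := @arg_maxnP _ x0 (mem c) odepth x0c.
  have [i p Ec] := rot_to xc.
  have Up : uniq (x :: p) by rewrite -Ec rot_uniq.
  have Cp : cycle rooted_edge (x :: p) by rewrite -Ec rot_cycle.
  have Mp y : y \in p -> odepth y <= odepth x.
    by move=> yp; apply: xmax; rewrite inE -(mem_rot i) Ec inE yp orbT.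
  have up y : y \in p -> rooted_edge x y -> is_parent y x.
    move=> yp /orP[/odepth_parent|//]; by rewrite ltnNge Mp.
  have uniq_parent y z : is_parent y x -> is_parent z x -> y = z.
    by case: (x) => [t|] //= /eqP <- /eqP.
  have sp : 1 < size p by rewrite -ltnS -[(size p).+1]/(size (x :: p)) -Ec size_rot.
  case: p sp Up Cp Mp up {Ec} => [|y p] //; case/lastP: p => [|p z] // _ Up Cp _ up.
  have Eyz : y = z.
    apply: uniq_parent; apply: up; rewrite ?inE ?mem_rcons ?inE ?eqxx ?orbT //.
      by move: Cp => /= /andP[].
    by move: Cp; rewrite /= !rcons_path last_rcons => /and3P[_ _]; rewrite rooted_edge_sym.
  by move: Up; rewrite /= Eyz mem_rcons mem_head andbF.
Qed.

Lemma rooted_graph_degree D :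
  (forall x, #|children x| <= D) -> max_degree rooted_graph <= D.+1.
Proof.
move=> degD; apply/bigmax_leqP => x _.
(* At the root, [P] is a dummy value; it can only enlarge the set that bounds the neighbourhood. *)
pose P := if x is Some t then parent t else None.
apply: (@leq_trans #|P |: Some @: children x|).
  apply: subset_leq_card; apply/subsetP => y.
  rewrite !inE => /orP[|] /=.
    case: y => //= t /eqP Pt; apply/orP; right.
    by apply/imsetP; exists t; rewrite // inE Pt.
  by rewrite /P; case: x {P} => //= t /eqP ->; rewrite eqxx.
rewrite (leq_trans (leq_card_setU _ _)) // cards1 add1n ltnS.
by rewrite (leq_trans (leq_imset_card _ _)).
Qed.

End RootedTree.

(** * Operations on rooted trees *)

Definition empty_rooted_tree : rooted_tree.
Proof. by exists void (fun=> None) (fun=> 0). Defined.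

(** The old root turns into a proper node, the element [None] of [option T], and is the only child
    of the new implicit root. *)
Definition add_root (T : rooted_tree) : rooted_tree.
Proof.
exists (option T) (fun x => if x is Some t then Some (parent t) else None)
  (@odepth T) => s [t|] // [<-].
exact/odepth_parent/eqxx.
Defined.

(** Because roots are implicit, the disjoint union of the nodes already identifies the two roots. *)
Definition join_roots (T1 T2 : rooted_tree) : rooted_tree.
Proof.
exists (T1 + T2)%type
  (fun x => match x with
            | inl t => omap inl (parent t)
            | inr t => omap inr (parent t)
            end)
  (fun x => match x with inl t => depth t | inr t => depth t end).
move=> [s|s] [t|t]; case E: (parent t) => [t'|] //= -[<-]; exact: depth_parent.
Defined.

Lemma leq_card_bigcup (I T : finType) (P : pred I) (F : I -> {set T}) :
  #|\bigcup_(i | P i) F i| <= \sum_(i | P i) #|F i|.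
Proof.
elim/big_rec2: _ => [|i n A _ leAn]; first by rewrite cards0.
by apply: leq_trans (leq_card_setU _ _) _; rewrite leq_add2l.
Qed.

Lemma children_add_root_None (T : rooted_tree) :
  #|children (None : option (add_root T))| <= 1.
Proof.
rewrite -(cards1 (None : add_root T)).
by apply/subset_leq_card/subsetP => -[t|]; rewrite !inE.
Qed.

Lemma children_add_root_Some (T : rooted_tree) (p : option T) :
  #|children (Some p : option (add_root T))| = #|children p|.
Proof.
rewrite -[RHS](card_imset _ (@Some_inj _)); apply: (@eq_card (add_root T)) => -[t|].
  by rewrite mem_imset ?inE //; exact: Some_inj.
by rewrite inE /=; apply/esym/imsetP => -[].
Qed.

Lemma rooted_edge_add_root (T : rooted_tree) (x y : option T) :
  rooted_edge (Some x : option (add_root T)) (Some y) = rooted_edge x y.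
Proof. by case: x y => [x|] [y|]. Qed.

Section JoinRoots.
Variables T1 T2 : rooted_tree.
Let T := join_roots T1 T2.

Let inl_inj : injective (@inl T1 T2). Proof. by move=> x y []. Qed.
Let inr_inj : injective (@inr T1 T2). Proof. by move=> x y []. Qed.

Definition join_inl (x : option T1) : option T := omap inl x.
Definition join_inr (x : option T2) : option T := omap inr x.

Lemma children_join_None :
  #|children (None : option T)| =
  #|children (None : option T1)| + #|children (None : option T2)|.
Proof.
rewrite -(card_imset (mem (children (None : option T1))) inl_inj).
rewrite -(card_imset (mem (children (None : option T2))) inr_inj).
rewrite -cardsUI (_ : _ :&: _ = set0) ?cards0 ?addn0; last first.
  apply/setP => x; rewrite !inE; apply/negP => /andP[/imsetP[y _ ->]].
  by case/imsetP.
apply: (@eq_card T) => -[x|x]; rewrite !inE /=.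
  rewrite mem_imset ?inE; last exact: inl_inj.
  rewrite orbC (_ : (_ \in _) = false) /=; last by apply/imsetP => -[].
  by case: (parent x).
rewrite [X in _ || X]mem_imset ?inE; last exact: inr_inj.
rewrite (_ : (_ \in _) = false) /=; last by apply/imsetP => -[].
by case: (parent x).
Qed.

Lemma children_join_inl t :
  #|children (Some (inl t) : option T)| = #|children (Some t)|.
Proof.
rewrite -[RHS](card_imset _ inl_inj); apply: (@eq_card T) => -[x|x].
  rewrite mem_imset ?inE /=; last exact: inl_inj.
  by case: (parent x).
rewrite inE /= (_ : (_ \in _) = false); last by apply/imsetP => -[].
by case: (parent x).
Qed.

Lemma children_join_inr t :
  #|children (Some (inr t) : option T)| = #|children (Some t)|.
Proof.
rewrite -[RHS](card_imset _ inr_inj); apply: (@eq_card T) => -[x|x].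
  rewrite inE /= (_ : (_ \in _) = false); last by apply/imsetP => -[].
  by case: (parent x).
rewrite mem_imset ?inE /=; last exact: inr_inj.
by case: (parent x).
Qed.

Lemma rooted_edge_inl x y :
  rooted_edge (join_inl x) (join_inl y) = rooted_edge x y.
Proof.
suff E p z : is_parent (join_inl p) (join_inl z) = is_parent p z.
  by rewrite /rooted_edge !E.
case: z => [z|] //=; case: p => [p|] /=; by case: (parent z).
Qed.

Lemma rooted_edge_inr x y :
  rooted_edge (join_inr x) (join_inr y) = rooted_edge x y.
Proof.
suff E p z : is_parent (join_inr p) (join_inr z) = is_parent p z.
  by rewrite /rooted_edge !E.
case: z => [z|] //=; case: p => [p|] /=; by case: (parent z).
Qed.

End JoinRoots.

(** * Tree-partitions from balanced separators *)

Section TreePartition.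
Variables (H : sgraph) (k d : nat).
Hypotheses (k0 : 0 < k) (d0 : 0 < d) (degH : max_degree H <= d).
Hypothesis sep : forall S : {set H}, exists2 X : {set H}, #|X| <= k &
  forall x, x \notin X -> 2 * #|S :&: component_avoiding X x| <= #|S|.

(* A closed set meeting [S] in more than [k] vertices and minimal as such
   meets [S] in at most [k + #|S|/2] vertices, since it exceeds by one
   component a closed set meeting [S] in at most [k] vertices. *)
Lemma balanced_split (S : {set H}) : 6 * k < #|S| ->
  exists X A : {set H}, [/\ #|X| <= k, [disjoint A & X],
    forall u v, u \in A -> edge u v -> v \notin X -> v \in A,
    k < #|S :&: A| & k < #|S :\: (A :|: X)|].
Proof.
move=> largeS; have [X smallX balX] := sep S.
pose closed_big (A : {set H}) := [&& [disjoint A & X],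
  [forall u in A, forall v, edge u v ==> (v \notin X) ==> (v \in A)]
  & k < #|S :&: A|].
have smallSX : #|S :&: X| <= k.
  by apply: leq_trans smallX; rewrite subset_leq_card ?subsetIr.
have [|A /minsetP[/and3P[dA /forall_inP cA bA] minA]] := @ex_minset _ closed_big.
  exists (~: X); apply/and3P; split.
  - by rewrite disjoint_sym disjoints_subset setCK.
  - by apply/forall_inP => u _; apply/forallP => v; rewrite inE; apply/implyP => _; apply/implyP.
  - by have := cardsID X S; rewrite setDE; lia.
have {}cA u v : u \in A -> edge u v -> v \notin X -> v \in A.
  by move=> uA uv vX; have /forallP/(_ v) := cA u uA; rewrite uv vX.
exists X, A; split => //.
have [x] : exists x, x \in S :&: A by apply/card_gt0P; lia.
case/setIP => xS xA.
have xX : x \notin X by rewrite (disjointFr dA xA).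
pose C := component_avoiding X x.
have CA : C \subset A.
  apply/subsetP => y; rewrite inE => /connectP[p].
  elim: p x xA {xS xX C} => [|z p IHp] x xA /= => [_ -> //|].
  by case/andP=> /and3P[xz _ zX] zp; apply: IHp => //; apply: cA xz zX.
have smallSAC : #|S :&: (A :\: C)| <= k.
  rewrite leqNgt; apply/negP => bAC.
  have xC : x \in C by rewrite inE connect0.
  suff EAC : A :\: C = A by move: xA; rewrite -EAC inE xC.
  apply: minA; last exact: subsetDl.
  rewrite /closed_big bAC andbT; apply/andP; split.
    by apply: disjointWl dA; apply: subsetDl.
  apply/forall_inP => u /setDP[uA uC]; apply/forallP => v; apply/implyP => uv; apply/implyP => vX.
  rewrite inE (cA u) // andbT; apply: contra uC; rewrite !inE => xv.
  by apply: connect_trans xv (connect1 _); rewrite /= edge_sym uv vX (disjointFr dA uA).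
have := balX x xX; rewrite -/C => halfC.
have E1 : #|S :&: A| = #|S :&: C| + #|S :&: (A :\: C)|.
  rewrite -[LHS](cardsID C) setIDA -setIA.
  by congr (#|_ :&: _| + _); apply/setIidPr.
have E2 := cardsID (A :|: X) S.
have E3 : #|S :&: (A :|: X)| <= #|S :&: A| + #|S :&: X|.
  by rewrite setIUr leq_card_setU.
(* So [S] meets [A :|: X] in at most [#|S| / 2 + 2 * k] vertices, and [6 * k < #|S|] leaves more
   than [k] outside. *)
by lia.
Qed.

(** Invariant of the recursion: [U] is the part of [H] being partitioned, and [S] is forced into the
    root bag. The root has its own bound [2 ^ #|S|] because gluing two roots adds their bags and
    their children, and a sum of two such powers with smaller exponents is again at most
    [2 ^ #|S|]. *)
Definition rooted_partition (U S : {set H}) (W : nat) (T : rooted_tree)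
    (f : H -> option T) : Prop :=
  [/\ forall u v, u \in U -> v \in U -> edge u v ->
        f u = f v \/ rooted_edge (f u) (f v),
      forall v, v \in S -> f v = None,
      #|U :&: f @^-1: [set None]| <= 2 ^ #|S|,
      #|children (None : option T)| <= 2 ^ #|S|
    & forall t : T, #|U :&: f @^-1: [set Some t]| <= W /\
        #|children (Some t)| <= W].

(** Induction on [#|U|]. A root bag of at most [6 * k] vertices has at most [6 * k * d] neighbours,
    which is the bound kept on [S]; splitting makes [S] smaller. Hence a root that becomes an
    ordinary node obeys the bound [2 ^ (6 * k * d)]. *)
Lemma rooted_partition_exists (U S : {set H}) :
  S \subset U -> #|S| <= 6 * k * d ->
  exists T f, @rooted_partition U S (2 ^ (6 * k * d)) T f.
Proof.
have [n] := ubnP #|U|; elim: n U S => // n IHn U S ltUn SU leS.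
have [largeS|smallS] := ltnP (6 * k) #|S|; last first.
  have [->|[x xU]] := set_0Vmem U.
    exists empty_rooted_tree, (fun=> None); split=> //.
    - by left.
    - by rewrite set0I cards0.
    - by rewrite (eq_card0 (_ : _ =i pred0)) // => -[].
  (* If [S] is empty, an arbitrary vertex forms the root bag, so that [U] shrinks; its size is still
     at most [2 ^ 0]. *)
  pose S' := if S == set0 then [set x] else S.
  have S'U : S' \subset U by rewrite /S'; case: ifP => // _; rewrite sub1set.
  have S'0 : 0 < #|S'|.
    by rewrite /S'; case: eqVneq => [|/set0Pn ?]; rewrite ?cards1 //; exact/card_gt0P.
  have S'k : #|S'| <= 6 * k by rewrite /S'; case: ifP => // _; rewrite cards1; lia.
  have S'2 : #|S'| <= 2 ^ #|S|.
    rewrite /S'; case: ifP => _; last exact/ltnW/ltn_expl.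
    by rewrite cards1 expn_gt0.
  have SS' : S \subset S' by rewrite /S'; case: eqVneq => [->|//]; rewrite sub0set.
  pose U' := U :\: S'.
  (* Forcing the neighbours of [S'] into the next root bag makes every edge leaving [S'] run between
     the new root and its only child. *)
  pose N := (\bigcup_(s in S') [set y | edge s y]) :&: U'.
  have leN : #|N| <= 6 * k * d.
    apply: leq_trans (_ : \sum_(s in S') #|[set y | edge s y]| <= _).
      apply: leq_trans (subset_leq_card (subsetIl _ _)) _.
      exact: leq_card_bigcup.
    apply: (@leq_trans (\sum_(s in S') d)).
      by apply: leq_sum => s _; apply: leq_trans degH; exact: leq_bigmax.
    by rewrite sum_nat_const leq_mul2r S'k orbT.
  have ltU' : #|U'| < n by rewrite cardsD (setIidPr S'U); move: ltUn S'0 (subset_leq_card S'U); lia.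
  have [T [f [ef fN bN cN bW]]] := IHn U' N ltU' (subsetIr _ _) leN.
  exists (add_root T), (fun v => if v \in S' then None else Some (f v)); split.
  - have cross u v : u \in S' -> v \in U -> v \notin S' -> edge u v -> f v = None.
      move=> uS vU vS uv; apply: fN; rewrite !inE vU vS !andbT.
      by apply/bigcupP; exists u; rewrite ?inE.
    move=> u v uU vU uv; case: ifPn => uS; case: ifPn => vS; first by left.
    + by right; rewrite (cross u v) // /rooted_edge /=.
    + by right; rewrite (cross v u) 1?edge_sym // /rooted_edge /=.
    + rewrite rooted_edge_add_root.
      have [| |//|->|] := ef u v; rewrite ?inE ?uS ?vS //; by [left|right].
  - by move=> v vS; rewrite (subsetP SS').
  - apply: leq_trans S'2; apply/subset_leq_card/subsetP => v.
    by rewrite !inE => /andP[_]; case: ifP.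
  - by rewrite (leq_trans (children_add_root_None _)) // expn_gt0.
  (* The old root is now an ordinary node, so its bounds [2 ^ #|N|] have to fit under the global
     one. *)
  - have N2 : 2 ^ #|N| <= 2 ^ (6 * k * d) by rewrite leq_exp2l.
    move=> t; rewrite children_add_root_Some.
    suff bag_t : #|U :&: (fun v => if v \in S' then None else Some (f v))
        @^-1: [set Some t]| <= #|U' :&: f @^-1: [set t]|.
      case: t bag_t => [t|] bag_t.
        by have [? ?] := bW t; split=> //; apply: leq_trans bag_t _.
      by split; [apply: leq_trans bag_t _|]; apply: leq_trans N2.
    apply/subset_leq_card/subsetP => v; rewrite !inE.
    by case: ifP => _; rewrite ?andbF.
have [X [A [smallX dAX cA bA bB]]] := balanced_split largeS.
(* The two parts overlap in [X :&: U], which is forced into both root bags. Each of [S1] and [S2]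
   gains at most [k] vertices from [X] and loses more than [k] vertices of [S] on the other side. *)
pose U1 := (A :|: X) :&: U; pose S1 := (S :&: A) :|: (X :&: U).
pose U2 := U :\: A; pose S2 := (S :\: A) :|: (X :&: U).
have ltS1 : #|S1| < #|S|.
  apply: leq_ltn_trans (leq_card_setU _ _) _.
  have : #|X :&: U| <= #|X| by rewrite subset_leq_card ?subsetIl.
  have : #|S :\: (A :|: X)| <= #|S :\: A| by rewrite subset_leq_card // setDS ?subsetUl.
  by have := cardsID A S; lia.
have ltS2 : #|S2| < #|S|.
  apply: leq_ltn_trans (leq_card_setU _ _) _.
  have : #|X :&: U| <= #|X| by rewrite subset_leq_card ?subsetIl.
  by have := cardsID A S; lia.
have ltU1 : #|U1| < n.
  apply: leq_trans (_ : #|U| <= n); last by [].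
  apply: proper_card; rewrite properE subsetIr /=.
  have [v] : exists v, v \in S :\: (A :|: X) by apply/card_gt0P; lia.
  case/setDP=> vS vAX; apply/negP => /subsetP/(_ v (subsetP SU v vS)).
  by rewrite inE (negPf vAX).
have ltU2 : #|U2| < n.
  apply: leq_trans (_ : #|U| <= n); last by [].
  apply: proper_card; rewrite properE subsetDl /=.
  have [v] : exists v, v \in S :&: A by apply/card_gt0P; lia.
  case/setIP=> vS vA; apply/negP => /subsetP/(_ v (subsetP SU v vS)).
  by rewrite inE vA.
have SU1 : S1 \subset U1.
  apply/subsetP => v; rewrite !inE => /orP[/andP[vS vA]|/andP[vX vU]].
    by rewrite vA (subsetP SU).
  by rewrite vX vU orbT.
have SU2 : S2 \subset U2.
  apply/subsetP => v; rewrite !inE => /orP[/andP[vA vS]|/andP[vX vU]].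
    by rewrite vA (subsetP SU).
  by rewrite vU (disjointFl dAX vX).
have leS1 : #|S1| <= 6 * k * d by lia.
have leS2 : #|S2| <= 6 * k * d by lia.
have [T1 [f1 [e1 S1f b1 c1 w1]]] := IHn U1 S1 ltU1 SU1 leS1.
have [T2 [f2 [e2 S2f b2 c2 w2]]] := IHn U2 S2 ltU2 SU2 leS2.
have two_halves a b : a <= 2 ^ #|S1| -> b <= 2 ^ #|S2| -> a + b <= 2 ^ #|S|.
  move=> ha hb; case: #|S| ltS1 ltS2 => // s; rewrite !ltnS expnS mul2n -addnn => h1 h2.
  by apply: leq_add; [apply: leq_trans ha _|apply: leq_trans hb _]; rewrite leq_exp2l.
(* On [X :&: U] both maps give the root, so [f] agrees with [f1] on all of [U1] and with [f2] on all
   of [U2]. *)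
pose f v : option (join_roots T1 T2) :=
  if v \in A then join_inl T2 (f1 v) else join_inr T1 (f2 v).
have f_1 v : v \in U1 -> f v = join_inl T2 (f1 v).
  rewrite !inE /f; case: ifP => //= vA /andP[vX vU].
  by rewrite S2f ?S1f // !inE vX vU ?vA orbT.
have f_2 v : v \in U2 -> f v = join_inr T1 (f2 v) by rewrite inE /f => /andP[/negPf ->].
have UU v : v \in U -> (v \in U1) || (v \in U2).
  by move=> vU; rewrite !inE vU !andbT orbAC orbN.
exists (join_roots T1 T2), f; split.
(* Edges with an end in [A] stay inside [U1], since [A] can be left only through [X]; all other
   edges lie inside [U2]. *)
- have half u v : u \in A -> v \in U -> edge u v -> v \in U1.
    move=> uA vU uv; rewrite !inE vU andbT orbC.
    by case: (boolP (v \in X)) => //= vX; exact: cA uv vX.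
  have AU1 u : u \in A -> u \in U -> u \in U1 by move=> uA uU; rewrite !inE uA uU.
  have in1 u v : u \in U1 -> v \in U1 -> edge u v -> f u = f v \/ rooted_edge (f u) (f v).
    move=> u1 v1 uv; rewrite !f_1 // rooted_edge_inl.
    by case: (e1 u v) => // [->|]; [left|right].
  move=> u v uU vU uv; have [uA|uA] := boolP (u \in A).
    by apply: in1 => //; [exact: AU1|exact: half uv].
  have [vA|vA] := boolP (v \in A).
    by apply: in1 => //; [apply: half vA _ _; rewrite // edge_sym|exact: AU1].
  rewrite !f_2 ?inE ?uA ?vA // rooted_edge_inr.
  have [| |//|->|] := e2 u v; rewrite ?inE ?uA ?vA //; by [left|right].
- move=> v vS; rewrite /f; case: ifP => vA.
    by rewrite S1f // !inE vS vA.
  by rewrite S2f // !inE vS vA.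
- apply: leq_trans (two_halves _ _ b1 b2).
  apply: leq_trans (leq_card_setU _ _); apply/subset_leq_card/subsetP => v.
  rewrite [v \in _ :&: _]inE => /andP[vU]; rewrite !inE /f vU.
  by case: ifP => vA /eqP; [case: (f1 v)|case: (f2 v) => //; rewrite orbT].
- by rewrite children_join_None two_halves.
- move=> [t|t].
    have [h1 h2] := w1 t; rewrite children_join_inl; split=> //.
    apply: leq_trans h1; apply/subset_leq_card/subsetP => v.
    rewrite !inE /f; case: ifP => vA /andP[-> /eqP]; last by case: (f2 v).
    by case: (f1 v) => //= x [->].
  have [h1 h2] := w2 t; rewrite children_join_inr; split=> //.
  apply: leq_trans h1; apply/subset_leq_card/subsetP => v.
  rewrite !inE /f; case: ifP => vA /andP[-> /eqP]; first by case: (f1 v).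
  by case: (f2 v) => //= x [->].
Qed.

Lemma tree_partition_of_separators :
  exists (T : sgraph) (bag : T -> {set H}),
    [/\ tree_partition bag, max_degree T <= (2 ^ (6 * k * d)).+1
      & tp_width bag <= 2 ^ (6 * k * d)].
Proof.
have le0 : #|(set0 : {set H})| <= 6 * k * d by rewrite cards0.
have [T [f [ef _ bN cN bW]]] := rooted_partition_exists (sub0set setT) le0.
have W0 : 2 ^ #|(set0 : {set H})| <= 2 ^ (6 * k * d) by rewrite leq_exp2l.
exists (rooted_graph T), (fun t => f @^-1: [set t]); split.
- split; first exact: rooted_graph_is_tree.
  + by move=> v; exists (f v); split=> [|t]; rewrite !inE // => /eqP.
  + move=> u v uv; have [fuv|fuv] := ef u v (in_setT u) (in_setT v) uv.
      by left; exists (f v); rewrite !inE fuv.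
    by right; exists (f u), (f v); rewrite !inE.
- apply: rooted_graph_degree => -[t|]; first by have [] := bW t.
  exact: leq_trans cN W0.
- apply/bigmax_leqP => -[t|] _; first by have [] := bW t; rewrite setTI.
  by apply: leq_trans W0; move: bN; rewrite setTI.
Qed.

End TreePartition.

(** * Tree decompositions and balanced separators *)

Lemma connect_restrict_sym (V : finType) (P : pred V) (e : rel V) : symmetric e ->
  connect_sym [rel a b | [&& e a b, P a & P b]].
Proof.
move=> se; apply: sym_connect_sym => a b /=.
by rewrite se [P a && P b]andbC.
Qed.

(** A walk of [G] that avoids [bag t] is followed in [T]: consecutive vertices share a bag, and the
    nodes whose bags contain a given vertex of the walk are connected without using [t]. *)
Lemma mem_component_bags (G T : sgraph) (bag : T -> {set G}) (t : T) x y q q' :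
  tree_decomposition bag -> x \notin bag t ->
  y \in component_avoiding (bag t) x -> x \in bag q -> y \in bag q' ->
  connect [rel a b | [&& edge a b, a != t & b != t]] q q'.
Proof.
move=> [_ _ edge_in conn_bags] xt.
have local v s s' : v \notin bag t -> v \in bag s -> v \in bag s' ->
    connect [rel a b | [&& edge a b, a != t & b != t]] s s'.
  move=> vt vs vs'; move: (conn_bags v s s' vs vs').
  apply: connect_sub => a b /= /and3P[ab va vb]; apply: connect1 => /=.
  by rewrite ab /=; apply/andP; split; apply: contraNneq vt => <-.
rewrite inE => /connectP[p]; elim: p x q xt => [|z p IHp] x q xt /=.
  by move=> _ ->; exact: local.
case/andP=> /and3P[xz _ zt] zp Ey xq yq'.
have [s [xs zs]] := edge_in x z xz.
apply: connect_trans (local x q s xt xq xs) _.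
exact: IHp z s zt zp Ey zs yq'.
Qed.

Section Weights.
Variable R : realType.
Local Open Scope ring_scope.

Lemma big_sets_meet (V : finType) (mu : V -> R) (A B : {set V}) :
  (forall x, 0 <= mu x) ->
  2^-1 * \sum_x mu x < \sum_(x in A) mu x ->
  2^-1 * \sum_x mu x < \sum_(x in B) mu x -> exists2 x, x \in A & x \in B.
Proof.
move=> mu0 bigA bigB; have [AB0|[x /setIP[]]] := set_0Vmem (A :&: B); last by exists x.
have dAB : [disjoint A & B] by rewrite -setI_eq0 AB0.
suff : \sum_(x in A) mu x + \sum_(x in B) mu x <= \sum_x mu x by lra.
rewrite -bigU //= [leRHS](bigID [in [predU A & B]]) /= lerDl.
exact: sumr_ge0.
Qed.

(** If no bag is balanced, every node [t] has a heavy component, whose bags all lie in one branch at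
    [t]; let [t] point to its neighbour in that branch. Some two adjacent nodes point to each other.
    Their heavy components share a vertex, and a bag containing it can be reached from either node
    while avoiding the other, although an edge of a tree is a bridge. *)
Lemma tree_decomposition_separator (G T : sgraph) (bag : T -> {set G})
    (mu : G -> R) : tree_decomposition bag -> (forall x, 0 <= mu x) ->
  exists t, balanced_separator mu (bag t).
Proof.
move=> tdec mu0; apply/not_existsP => unbalanced.
have [[_ connT _] in_bag _ _] := tdec; have treeT : is_tree T by case: tdec.
have {unbalanced} heavy t : exists x, x \notin bag t /\
    2^-1 * \sum_y mu y < \sum_(y in component_avoiding (bag t) x) mu y.
  apply/not_existsP => light; apply: (unbalanced t) => x xt.
  by rewrite leNgt; apply/negP => hx; apply: (light x).
pose avoid t : rel T := [rel a b | [&& edge a b, a != t & b != t]].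
have toward t : exists y, edge t y /\ exists C : {set G},
    2^-1 * \sum_y mu y < \sum_(y in C) mu y /\
    forall v q, v \in C -> v \in bag q -> connect (avoid t) y q.
  have [x [xt heavy_x]] := heavy t; have [s xs] := in_bag x.
  have /connectP[p pP lastp] := connT t s.
  (* On a simple path from [t] to a bag containing [x], the first step [y] gives the direction, and
     the rest of the path never returns to [t]. *)
  case/shortenP: pP lastp => -[|y p'] /=.
    by move=> _ _ _ Es; move: xt; rewrite Es in xs *; rewrite xs.
  case/andP=> ty yp /andP[t_notin _] _ Es.
  exists y; split=> //; exists (component_avoiding (bag t) x); split=> // v q vC vq.
  apply: connect_trans (mem_component_bags tdec xt vC xs vq).
  apply/connectP; exists p' => //.
  apply: (sub_in_path (P := predC1 t)) yp.
    by move=> a b; rewrite !inE /avoid /= => -> -> ->.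
  apply/allP => z zp /=; apply: contraNneq t_notin => <-; exact: zp.
have [f fP] := fin_all_exists toward.
have [s fs] := tree_mutual_pointers treeT (fun t => (fP t).1).
have [st [C [heavyC toC]]] := fP s; have [ts [D [heavyD toD]]] := fP (f s).
have [v vC vD] := big_sets_meet mu0 heavyC heavyD.
have [q vq] := in_bag v.
have := toC v q vC vq; have := toD v q vD vq; rewrite fs => sq tq.
have := tree_no_return treeT st; case/negP.
apply: (@connect_trans _ _ q).
  apply: connect_sub sq => a b /= /and3P[ab _ /negPf bt].
  by apply: connect1; rewrite /= ab bt andbF.
have {}tq : connect (avoid s) q (f s).
  by rewrite connect_restrict_sym //; exact: edge_sym.
apply: connect_sub tq => a b /= /and3P[ab /negPf as_ _].
by apply: connect1; rewrite /= ab as_.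
Qed.

Lemma coverable_mono (G : sgraph) k k' rho rho' (A A' : {set G}) :
  (k <= k')%N -> rho <= rho' -> A' \subset A ->
  @coverable R G k rho A -> coverable k' rho' A'.
Proof.
move=> kk' rr' AA' [S [Sk AS]]; exists S; split; first exact: leq_trans kk'.
apply: fintype.subset_trans AA' (fintype.subset_trans AS _).
apply/fintype.subsetP => v /finset.bigcupP[s sS]; rewrite inE => vs.
by apply/finset.bigcupP; exists s; rewrite // inE (le_trans vs) // lee_fin.
Qed.

Lemma coverable_bigcup (G : sgraph) (I : finType) (P : {set I}) k n rho
    (A : I -> {set G}) : (#|P| <= n)%N ->
  (forall i, i \in P -> @coverable R G k rho (A i)) ->
  coverable (n * k) rho (\bigcup_(i in P) A i).
Proof.
move=> Pn covA.
have /fin_all_exists[S SP] i : exists S : {set G}, i \in P ->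
    (#|S| <= k)%N /\ A i \subset \bigcup_(s in S) ball s rho.
  case: (boolP (i \in P)) => [iP|_]; last by exists finset.set0.
  by have [S SP] := covA i iP; exists S.
exists (\bigcup_(i in P) S i); split.
  apply: leq_trans (leq_card_bigcup _ _) _.
  apply: (@leq_trans (\sum_(i in P) k)); first by apply: leq_sum => i /SP[].
  by rewrite sum_nat_const leq_mul2r Pn orbT.
apply/finset.bigcupsP => i iP; have [_ /fintype.subsetP AS] := SP i iP.
apply/fintype.subsetP => v /AS /finset.bigcupP[s sS vs].
by apply/finset.bigcupP; exists s => //; apply/finset.bigcupP; exists i.
Qed.

End Weights.

Definition closed_nbh (T : sgraph) (t : T) : {set T} := [set s | (s == t) || edge t s].

Lemma card_closed_nbh (T : sgraph) (t : T) : #|closed_nbh t| <= (max_degree T).+1.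
Proof.
rewrite /closed_nbh (_ : [set s | _] = t |: [set s | edge t s]); last first.
  by apply/setP => s; rewrite !inE.
apply: leq_trans (leq_card_setU _ _) _; rewrite cards1 add1n ltnS.
exact: (leq_bigmax (F := fun x : T => #|[set y | edge x y]|)).
Qed.

(** If [v] lies in the part at [c], then the nodes whose new bags contain [v] form the star around
    [c], which is connected. *)
Lemma tree_decomposition_of_partition (G T : sgraph) (bag : T -> {set G}) :
  tree_partition bag ->
  tree_decomposition (fun t => \bigcup_(s in closed_nbh t) bag s).
Proof.
move=> [treeT part edge_bag].
have nbh_refl (t : T) : t \in closed_nbh t by rewrite inE eqxx.
split=> //.
- move=> v; have [t [vt _]] := part v; exists t.
  by apply/bigcupP; exists t.
- move=> u v uv; have [[t [ut vt]]|[s [t [st us vt]]]] := edge_bag u v uv.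
    by exists t; split; apply/bigcupP; exists t.
  exists s; split; first by apply/bigcupP; exists s.
  by apply/bigcupP; exists t; rewrite // inE st orbT.
- move=> v; have [c [vc c_uniq]] := part v.
  pose e := [rel a b : T | [&& edge a b, v \in \bigcup_(s in closed_nbh a) bag s
    & v \in \bigcup_(s in closed_nbh b) bag s]].
  have vC : v \in \bigcup_(s in closed_nbh c) bag s by apply/bigcupP; exists c.
  have to_c s : v \in \bigcup_(s' in closed_nbh s) bag s' -> connect e s c.
    move=> vs; have /bigcupP[s' + vs'] := vs; rewrite inE -(c_uniq s' vs').
    by case/orP=> [/eqP ->|sc]; [exact: connect0|apply: connect1; rewrite /= sc vs].
  move=> s t vs vt; apply: connect_trans (to_c s vs) _.
  rewrite connect_restrict_sym; [exact: to_c|exact: edge_sym].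
Qed.

(** * Distances and nets *)

Section Distances.
Variable R : realType.
Local Open Scope ring_scope.

Lemma dist_le_walk (H : wgraph R) (u : H) p : path (@edge H) u p ->
  (dist u (last u p) <= (walk_length u p)%:E)%E.
Proof. by move=> pP; apply: ereal_inf_lbound; exists p. Qed.

Lemma dist_lt_walk (H : wgraph R) (u v : H) (x : R) : (dist u v < x%:E)%E ->
  exists p, [/\ path (@edge H) u p, last u p = v & walk_length u p < x].
Proof.
by move=> /ereal_inf_lt[_ [p [pP lastp ->]]]; rewrite lte_fin; exists p.
Qed.

Lemma le_dist (H : wgraph R) (u v : H) (x : \bar R) :
  (forall p, path (@edge H) u p -> last u p = v ->
    (x <= (walk_length u p)%:E)%E) -> (x <= dist u v)%E.
Proof. by move=> lb; apply: le_ereal_inf_tmp => _ [p [pP lastp ->]]; exact: lb. Qed.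

Lemma dist_ge0 (H : wgraph R) (u v : H) : (0 <= dist u v)%E.
Proof.
apply: le_dist => p _ _; rewrite lee_fin.
by elim: p u => //= y p IHp u; rewrite addr_ge0 ?weight_ge0.
Qed.

Lemma walk_length_ge (H : wgraph R) (w : R) (u : H) p :
  (forall x y : H, edge x y -> w <= weight x y) -> path (@edge H) u p ->
  w * (size p)%:R <= walk_length u p.
Proof.
move=> ew; elim: p u => [|y p IHp] u /=; first by rewrite mulr0.
by case/andP=> uy yp; rewrite -natr1 mulrDr mulr1 addrC lerD ?ew ?IHp.
Qed.

Lemma walk_length_const (H : wgraph R) (w : R) (u : H) p :
  (forall x y : H, edge x y -> weight x y = w) -> path (@edge H) u p ->
  walk_length u p = w * (size p)%:R.
Proof.
move=> ew; elim: p u => [|y p IHp] u /=; first by rewrite mulr0.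
by case/andP=> uy yp; rewrite -natr1 mulrDr mulr1 addrC ew ?IHp.
Qed.

Lemma walk_length_unit (G : sgraph) (u : G) p :
  @walk_length R (unit_weighted R G) u p = (size p)%:R.
Proof. by elim: p u => //= y p IHp u; rewrite IHp -natr1 addrC. Qed.

Variable G : sgraph.
Implicit Types u v w : G.

Lemma gdist_le_walk u p : path (@edge G) u p ->
  (gdist R u (last u p) <= (size p)%:R%:E)%E.
Proof. by move=> /(@dist_le_walk (unit_weighted R G)); rewrite walk_length_unit. Qed.

(** The infimum is attained because unit lengths are integers: a walk of length less than
    [trunc x + 1] has at most [trunc x] edges. *)
Lemma gdistP u v (x : R) : 0 <= x ->
  (gdist R u v <= x%:E)%E <->
  exists p, [/\ path (@edge G) u p, last u p = v & (size p)%:R <= x].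
Proof.
move=> x0; split=> [uv|[p [pP <- px]]]; last first.
  by apply: le_trans (gdist_le_walk pP) _; rewrite lee_fin.
have /dist_lt_walk[p [pP lastp]] :
    (@dist R (unit_weighted R G) u v < (Num.trunc x).+1%:R%:E)%E.
  by apply: le_lt_trans uv _; rewrite lte_fin truncnS_gt.
rewrite walk_length_unit ltr_nat ltnS => px; exists p; split=> //.
by apply: le_trans (_ : (Num.trunc x)%:R <= x); rewrite ?ler_nat ?truncn_le.
Qed.

Lemma gdist_sym u v : gdist R u v = gdist R v u.
Proof.
have le_rev (x y : G) : (gdist R x y <= gdist R y x)%E; last first.
  by apply/le_anti; rewrite !le_rev.
apply: (@le_dist (unit_weighted R G)) => p pP <-; rewrite walk_length_unit.
have := @gdist_le_walk (last y p) (rev (belast y p)).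
rewrite size_rev size_belast (_ : last _ (rev _) = y); last first.
  by case: p {pP} => //= z p; rewrite rev_cons last_rcons.
apply; rewrite rev_path; apply: sub_path pP => a b; by rewrite edge_sym.
Qed.

Lemma gdist_triangle u v w (x y : R) : 0 <= x -> 0 <= y ->
  (gdist R u v <= x%:E)%E -> (gdist R v w <= y%:E)%E ->
  (gdist R u w <= (x + y)%:E)%E.
Proof.
move=> x0 y0 /(gdistP _ _ x0)[p [pP lastp px]] /(gdistP _ _ y0)[q [qP lastq qy]].
apply/gdistP; first exact: addr_ge0.
exists (p ++ q); rewrite cat_path last_cat lastp pP qP lastq size_cat natrD.
by split=> //; exact: lerD.
Qed.

Lemma gdist_refl u (x : R) : 0 <= x -> (gdist R u u <= x%:E)%E.
Proof. by move=> x0; apply: le_trans (gdist_refl_le0 R u) _; rewrite lee_fin. Qed.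

Lemma gdist_mem_walk u p x : path (@edge G) u p -> x \in u :: p ->
  (gdist R u x <= (size p)%:R%:E)%E.
Proof.
move=> + xp; case/splitPl: xp => p1 p2 <-; rewrite cat_path => /andP[p1P _].
by apply: le_trans (gdist_le_walk p1P) _; rewrite lee_fin ler_nat size_cat leq_addr.
Qed.

Lemma walk_avoiding (X : {set G}) u p : path (@edge G) u p ->
  (forall x, x \in u :: p -> x \notin X) ->
  connect [rel a b | [&& edge a b, a \notin X & b \notin X]] u (last u p).
Proof.
move=> pP avoid; apply/connectP; exists p => //.
apply: (sub_in_path (P := [pred x | x \notin X])) pP.
  by move=> a b; rewrite !inE /= => -> -> ->.
by apply/allP => x /avoid.
Qed.

Variables (m : nat) (dd : doubling_dim_le R m G).

Lemma coverable_ball_iter (j : nat) (rho : R) u : 0 <= rho ->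
  coverable (2 ^ (m * j)) rho (ball u (2 ^+ j * rho)).
Proof.
move=> rho0; elim: j u => [|j IHj] u.
  rewrite muln0 expr0 mul1r; exists [set u]; rewrite cards1; split=> //.
  by apply/subsetP => v uv; apply/bigcupP; exists u; rewrite ?set11.
have rj0 : 0 <= 2 ^+ j * rho by rewrite mulr_ge0 // exprn_ge0.
have [S [Sm cov]] := dd u rj0.
rewrite mulnS expnD; rewrite mulrA -exprS in cov.
apply: coverable_mono (leqnn _) (lexx _) cov _.
by apply: coverable_bigcup => // s _; exact: IHj.
Qed.

(** A maximal sparse set is dense, since a vertex far from all its points could be added. *)
Lemma net_exists (r : R) : 0 <= r -> exists N : {set G},
  (forall a b, a \in N -> b \in N -> (gdist R a b <= r%:E)%E -> a = b) /\
  (forall v, exists2 a, a \in N & (gdist R v a <= r%:E)%E).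
Proof.
move=> r0.
pose sparse (N : {set G}) := `[< forall a b, a \in N -> b \in N ->
  (gdist R a b <= r%:E)%E -> a = b >].
have [|N /maxsetP[/asboolP spN maxN]] := @ex_maxset _ sparse.
  by exists finset.set0; apply/asboolP => a b; rewrite inE.
exists N; split=> // v; apply/exists2P; apply: contrapT => far.
have farP a : a \in N -> ~ (gdist R v a <= r%:E)%E by move=> aN va; apply: far; exists a.
have vN : v \in N.
  rewrite -(maxN (v |: N)) ?setU11 ?subsetUr //.
  apply/asboolP => a b; rewrite !inE => /predU1P[->|aN] /predU1P[->|bN] //.
  - by move/(farP b bN).
  - by rewrite gdist_sym => /(farP a aN).
  - exact: spN.
by case: (farP v vN); exact: gdist_refl.
Qed.

End Distances.

(** * The graph on a net *)

Section NetGraph.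
Variables (R : realType) (G : sgraph) (m r : nat).
Hypotheses (r0 : (0 < r)%N) (dd : doubling_dim_le R m G).
Variable N : {set G}.
Hypothesis sparse : forall a b : G, a \in N -> b \in N ->
  (gdist R a b <= r%:R%:E)%E -> a = b.
Local Open Scope ring_scope.

Let nn n : 0 <= n%:R :> R. Proof. exact: ler0n. Qed.

(** Three halvings take the radius from [4 * r] to [r / 2], and a ball of radius [r / 2] contains at
    most one net point. *)
Lemma net_packing (c : G) :
  (#|[set a in N | (gdist R c a <= (4 * r)%:R%:E)%E]| <= 2 ^ (m * 3))%N.
Proof.
set P := [set a in N | _].
have half0 : 0 <= r%:R / 2 :> R by rewrite divr_ge0.
have [S [Sm /subsetP cov]] := coverable_ball_iter dd 3 c half0.
have /fin_all_exists[f fP] a : exists s, a \in P ->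
    s \in S /\ (gdist R s a <= (r%:R / 2)%:E)%E.
  have [aP|_] := boolP (a \in P); last by exists c.
  have /bigcupP[s sS sa] : a \in \bigcup_(s in S) ball s (r%:R / 2 : R).
    apply: cov; move: aP; rewrite !inE => /andP[_ ca].
    by apply: le_trans ca _; rewrite lee_fin natrM; lra.
  by exists s => _; rewrite inE in sa.
rewrite -(card_in_imset (f := f) (D := P)).
  apply: leq_trans Sm; apply/subset_leq_card/subsetP => _ /imsetP[a aP ->].
  by case: (fP a aP).
move=> a b aP bP Eab; have [_ fa] := fP a aP; have [_ fb] := fP b bP.
move: aP bP; rewrite !inE => /andP[aN _] /andP[bN _]; apply: sparse => //.
rewrite (splitr r%:R); apply: (gdist_triangle half0 half0 _ fb).
by rewrite -Eab gdist_sym.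
Qed.

Definition net_edge (a b : {x | x \in N}) : bool :=
  (a != b) && (gdist R (val a) (val b) <= (3 * r)%:R%:E)%E.

Lemma net_edge_sym : symmetric net_edge.
Proof. by move=> a b; rewrite /net_edge eq_sym gdist_sym. Qed.

Lemma net_edge_irrefl : irreflexive net_edge.
Proof. by move=> a; rewrite /net_edge eqxx. Qed.

Definition net_graph := SGraph net_edge_sym net_edge_irrefl.

Lemma net_packing_graph (c : G) :
  (#|[set a : net_graph | (gdist R c (val a) <= (4 * r)%:R%:E)%E]| <= 2 ^ (m * 3))%N.
Proof.
apply: leq_trans (net_packing c); rewrite -(card_imset _ val_inj).
apply/subset_leq_card/subsetP => _ /imsetP[a + ->]; rewrite !inE => ->.
by rewrite andbT; exact: valP.
Qed.

Lemma net_degree : (max_degree net_graph <= 2 ^ (m * 3))%N.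
Proof.
apply/bigmax_leqP => a _; apply: leq_trans (net_packing_graph (val a)).
apply/subset_leq_card/subsetP => b; rewrite !inE => /andP[_ ab].
by apply: le_trans ab _; rewrite lee_fin ler_nat leq_mul2r orbT.
Qed.

Lemma sum_indicator (V : finType) (A B : {set V}) :
  \sum_(x in A) (x \in B)%:R = #|B :&: A|%:R :> R.
Proof.
rewrite -natr_sum; congr _%:R.
rewrite -sum1_card big_mkcond [RHS]big_mkcond /=; apply: eq_bigr => x _.
by rewrite inE; case: (x \in A); case: (x \in B).
Qed.

(** Let each net point in [S] have weight one, and let [Y] consist of the net points within [4 * r]
    of the centres of the balls covering [X]. A net edge outside [Y] lifts to a walk of [G] within
    [3 * r] of its start; a vertex of [X] on it would put the start within [3 * r + r] of a centre.
    So components outside [Y] lift into components outside [X]. *)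
Lemma net_separators (k : nat) : separable R G r k -> forall S : {set net_graph},
  exists2 Y : {set net_graph}, (#|Y| <= k * 2 ^ (m * 3))%N &
    forall a, a \notin Y -> (2 * #|S :&: component_avoiding Y a| <= #|S|)%N.
Proof.
move=> sepG S; pose mu (x : G) : R := (x \in [set val a | a in S])%:R.
have [|X [balX [Z [Zk /subsetP XZ]]]] := sepG mu; first by move=> x; exact: nn.
pose Y := \bigcup_(z in Z) [set a : net_graph | (gdist R z (val a) <= (4 * r)%:R%:E)%E].
have far a z : a \notin Y -> z \in Z -> ~ (gdist R z (val a) <= (4 * r)%:R%:E)%E.
  by move=> /negP aY zZ za; apply: aY; apply/bigcupP; exists z; rewrite ?inE.
have near_avoid a x : a \notin Y -> (gdist R (val a) x <= (3 * r)%:R%:E)%E -> x \notin X.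
  move=> aY ax; apply/negP => /XZ /bigcupP[z zZ]; rewrite inE => zx.
  apply: (far a z aY zZ); rewrite (mulSn 3) natrD; apply: gdist_triangle zx _ => //.
  by rewrite gdist_sym.
exists Y.
  apply: leq_trans (leq_card_bigcup _ _) _.
  apply: (@leq_trans (\sum_(z in Z) 2 ^ (m * 3))%N).
    by apply: leq_sum => z _; exact: net_packing_graph.
  by rewrite sum_nat_const leq_mul2r Zk orbT.
have lift a b : connect [rel a b : net_graph | [&& edge a b, a \notin Y & b \notin Y]] a b ->
    connect [rel x y | [&& edge x y, x \notin X & y \notin X]] (val a) (val b).
  case/connectP=> p; elim: p a => [|c p IHp] a /=; first by move=> _ ->; exact: connect0.
  case/andP=> /and3P[/andP[_ ac] aY cY] cp Eb.
  apply: connect_trans (IHp c cp Eb).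
  have /(gdistP _ _ (nn _))[q [qP <- sq]] := ac.
  apply: walk_avoiding => // x xq; apply: near_avoid aY _.
  by apply: le_trans (gdist_mem_walk _ qP xq) _; rewrite lee_fin.
move=> a aY.
have aX : val a \notin X by apply: near_avoid aY _; exact: gdist_refl.
have := balX _ aX; rewrite sum_indicator.
(* Written over [[set: G]], the total weight is also an instance of [sum_indicator]. *)
rewrite [X in _ * X](eq_bigl (fun x => x \in [set: G])) => [|x]; last by rewrite inE.
rewrite sum_indicator setIT card_imset; last exact: val_inj.
set I := _ :&: _ => leI.
have leS : (#|S :&: component_avoiding Y a| <= #|I|)%N.
  rewrite -(card_imset _ val_inj); apply/subset_leq_card/subsetP => _ /imsetP[b + ->].
  by rewrite !inE => /andP[bS /lift ->]; rewrite andbT imset_f.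
by rewrite -(ler_nat R) natrM; rewrite -(ler_nat R) in leS; lra.
Qed.

Variable phi : G -> net_graph.
Hypothesis phiP : forall v, (gdist R v (val (phi v)) <= r%:R%:E)%E.

(** This explains the threshold [3 * r]: one [r] between [u] and [v], and one from each of them to
    its net point. *)
Lemma net_map_near (u v : G) : (gdist R u v <= r%:R%:E)%E ->
  phi u = phi v \/ edge (phi u) (phi v).
Proof.
move=> uv; have [->|neq] := eqVneq (phi u) (phi v); [by left|right].
rewrite /edge /= /net_edge neq /= (_ : (3 * r)%N = r + (r + r))%N; last by rewrite !mulSn addn0.
rewrite !natrD; apply: (gdist_triangle (v := u)); rewrite -?natrD //.
  by rewrite gdist_sym.
rewrite natrD; exact: gdist_triangle uv (phiP v).
Qed.

(** The walk is cut into pieces of length at most [r], each costing at most one net edge; the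
    successor accounts for the last piece. *)
Lemma net_walk (u : G) p : path (@edge G) u p -> exists q,
  [/\ path (@edge net_graph) (phi u) q, last (phi u) q = phi (last u p)
    & (size q <= (size p %/ r).+1)%N].
Proof.
have [n] := ubnP (size p); elim: n p u => // n IHn p u ltpn pP.
have hop (v w : G) : (gdist R v w <= r%:R%:E)%E -> exists q,
  [/\ path (@edge net_graph) (phi v) q, last (phi v) q = phi w & (size q <= 1)%N].
  case/net_map_near => [Evw|vw]; first by exists [::].
  by exists [:: phi w]; split=> //=; rewrite andbT.
have [short|long] := leqP (size p) r.
  have [|q [qP lastq q1]] := hop u (last u p).
    by apply: le_trans (gdist_le_walk _ pP) _; rewrite lee_fin ler_nat.
  by exists q; split=> //; apply: leq_trans q1 _.
have := pP; rewrite -{1}(cat_take_drop r p) cat_path => /andP[p1P p2P].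
have [|q2 [q2P lastq2 sq2]] := IHn (drop r p) (last u (take r p)) _ p2P.
  by rewrite size_drop; lia.
have [|q1 [q1P lastq1 sq1]] := hop u (last u (take r p)).
  apply: le_trans (gdist_le_walk _ p1P) _.
  by rewrite lee_fin ler_nat size_take; case: ifP => //; lia.
exists (q1 ++ q2); rewrite cat_path last_cat lastq1 q1P q2P lastq2.
rewrite -last_cat cat_take_drop; split=> //.
rewrite size_cat (leq_trans (leq_add sq1 sq2)) // add1n ltnS size_drop.
rewrite -{2}(subnK (ltnW long)) divnDr ?divnn ?r0 ?addn1 //.
Qed.

Definition weighted_net_graph : wgraph R :=
  @WGraph R net_graph (fun _ _ => 3 * r%:R) (fun _ _ => erefl)
    (fun _ _ => mulr_ge0 (nn 3) (nn r)).

(** A net edge has weight [3 * r] and spans distance at most [3 * r] in [G], so the distance in [G]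
    exceeds that of the images by at most [2 * r]. Conversely a walk of length [n] costs at most
    [3 * r * (n %/ r + 1) <= 3 * n + 3 * r]. *)
Lemma net_quasi_isometric :
  quasi_isometric 3 (3 * r%:R) (unit_weighted R G) weighted_net_graph.
Proof.
split; first by lra.
  by rewrite mulr_ge0.
have w_edge (x y : weighted_net_graph) : edge x y -> weight x y = 3 * r%:R by [].
exists phi; split=> [u v|w].
  split.
    apply: le_dist => q qP lastq; rewrite (walk_length_const w_edge) //.
    have hops (a : net_graph) : path (@edge net_graph) a q ->
        (gdist R (val a) (val (last a q)) <= (3 * r%:R * (size q)%:R)%:E)%E.
      elim: q a {qP lastq} => [|b q IHq] a /=; first by rewrite mulr0 => _; exact: gdist_refl.
      case/andP=> /andP[_ ab] /IHq bq; rewrite -[(size q).+1%:R]natr1 mulrDr mulr1 addrC.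
      rewrite natrM in ab; apply: (gdist_triangle _ _ ab bq); by rewrite ?mulr_ge0.
    have uv : (gdist R u v <= (r%:R + (3 * r%:R * (size q)%:R + r%:R))%:E)%E.
      have pos : 0 <= 3 * r%:R * (size q)%:R :> R by rewrite !mulr_ge0.
      apply: (gdist_triangle (nn r) (addr_ge0 pos (nn r)) (phiP u)).
      apply: (gdist_triangle pos (nn r) (hops _ qP)).
      by rewrite lastq gdist_sym.
    move: uv; rewrite -/(gdist R u v); case: (gdist R u v) => [d||] //.
      move=> uv; rewrite -EFinM -EFinB lee_fin; move: uv; rewrite lee_fin => uv.
      have := nn r; have := nn (size q).
      have pos : 0 <= r%:R * (size q)%:R :> R by rewrite mulr_ge0.
      by lra.
    by move=> _; rewrite gt0_muleNy ?lte_fin // leNye.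
  have := @dist_ge0 R (unit_weighted R G) u v.
  rewrite -/(gdist R u v); case E: (gdist R u v) => [d||] // d0.
    have d0' : 0 <= d by [].
    have /(gdistP _ _ d0')[p [pP <- pd]] : (gdist R u v <= d%:E)%E by rewrite E.
    have [q [qP <- sq]] := net_walk pP.
    apply: le_trans (@dist_le_walk R weighted_net_graph _ _ qP) _.
    rewrite (walk_length_const w_edge) // -EFinM -EFinD lee_fin.
    apply: (@le_trans _ _ (3 * (r * (size p %/ r).+1)%:R)).
      by rewrite -mulrA ler_wpM2l // -natrM ler_nat leq_mul2l sq orbT.
    rewrite mulnS natrD; have : (r * (size p %/ r) <= size p)%N by rewrite mulnC leq_trunc_div.
    rewrite -(ler_nat R); lra.
    by rewrite gt0_muley ?lte_fin // leey.
exists (val w).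
have [<-|] : w = phi (val w) \/ edge w (phi (val w)).
- have [<-|neq] := eqVneq w (phi (val w)); [by left|right].
  rewrite /edge /= /net_edge neq /=; apply: le_trans (phiP (val w)) _.
  by rewrite lee_fin ler_nat leq_pmull.
- apply: le_trans (@dist_le_walk R weighted_net_graph w [::] isT) _.
  by rewrite lee_fin mulr_ge0.
- move=> wphi; apply: le_trans (@dist_le_walk R weighted_net_graph w [:: phi (val w)] _) _.
  by rewrite /= andbT.
by rewrite /= addr0.
Qed.

End NetGraph.

(** * The five conditions *)

(** Balls in the number of edges, independent of weights. Stepping through closed neighbourhoods
    allows waiting, so walks of at most [n] edges are included. *)
Fixpoint reach (H : sgraph) (n : nat) (x : H) : {set H} :=
  if n is n'.+1 then \bigcup_(y in closed_nbh x) reach n' y else [set x].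

Lemma card_reach (H : sgraph) n (x : H) : #|reach n x| <= (max_degree H).+1 ^ n.
Proof.
elim: n x => [|n IHn] x /=; first by rewrite cards1.
apply: leq_trans (leq_card_bigcup _ _) _.
apply: (@leq_trans (\sum_(y in closed_nbh x) (max_degree H).+1 ^ n)).
  by apply: leq_sum => y _; exact: IHn.
by rewrite sum_nat_const expnS leq_mul2r card_closed_nbh orbT.
Qed.

Lemma reachP (H : sgraph) n (x y : H) :
  reflect (exists p, [/\ path (@edge H) x p, last x p = y & size p <= n])
    (y \in reach n x).
Proof.
apply: (iffP idP).
  elim: n x => [|n IHn] x /=; first by move/set1P => ->; exists [::].
  case/bigcupP=> z; rewrite inE => /orP[/eqP ->|xz] /IHn[p [pP lastp pn]].
    by exists p; split=> //; apply: leqW.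
  by exists (z :: p); rewrite /= xz.
case=> p [pP lastp pn]; elim: n x p pP lastp pn => [|n IHn] x [|z p] //=.
- by move=> _ <- _; rewrite set11.
- by move=> _ Exy _; apply/bigcupP; exists x; [rewrite inE eqxx|apply: (IHn x [::])].
case/andP=> xz zp lastp pn; apply/bigcupP; exists z; first by rewrite inE xz orbT.
exact: IHn lastp pn.
Qed.

(* A vertex goes to every node whose bag meets the ball of radius [L] around
   its image, a connected set of vertices of [H]. *)
Lemma pullback_tree_decomposition (G H T : sgraph) (bag : T -> {set H})
    (phi : G -> H) (L : nat) :
  tree_partition bag ->
  (forall u v : G, edge u v -> phi v \in reach L (phi u)) ->
  tree_decomposition (fun t => [set v | [exists y in bag t, phi v \in reach L y]]).
Proof.
move=> [treeT part edge_bag] near.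
have in_bag x s t : x \in bag s -> x \in bag t -> s = t.
  by have [c [_ c_uniq]] := part x; move=> /c_uniq <- /c_uniq <-.
have self (x : H) : x \in reach L x by apply/reachP; exists [::].
split=> //.
- move=> v; have [t [vt _]] := part (phi v); exists t; rewrite inE.
  by apply/exists_inP; exists (phi v).
- move=> u v uv; have [t [ut _]] := part (phi u); exists t; rewrite !inE.
  by split; apply/exists_inP; exists (phi u) => //; exact: near.
- move=> v; have [c [vc _]] := part (phi v).
  pose bag' t := [set v | [exists y in bag t, phi v \in reach L y]].
  have to_c s : v \in bag' s ->
      connect [rel a b | [&& edge a b, v \in bag' a & v \in bag' b]] s c.
    rewrite inE => /exists_inP[y ys /reachP[p [pP lastp pL]]].
    elim: p y s ys pP lastp pL => [|z p IHp] y s ys /=.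
      by move=> _ Ey _; rewrite (in_bag y s c) // Ey.
    case/andP=> yz zp lastp pL.
    have [[t [yt zt]]|[s' [t [st ys' zt]]]] := edge_bag y z yz.
      by rewrite (in_bag _ _ _ ys yt); apply: (IHp z) => //; exact: ltnW.
    rewrite (in_bag _ _ _ ys ys'); apply: connect_trans (IHp z t zt zp lastp (ltnW pL)).
    apply: connect1; rewrite /= st !inE /=; apply/andP; split; apply/exists_inP.
      by exists y => //; apply/reachP; exists (z :: p); rewrite /= yz.
    by exists z => //; apply/reachP; exists p; split=> //; exact: ltnW.
  move=> s t vs vt; apply: connect_trans (to_c s vs) _.
  rewrite (connect_restrict_sym [pred a | v \in bag' a] (@edge_sym T)).
  exact: to_c.
Qed.

Section Conditions.
Variable R : realType.
Local Open Scope ring_scope.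

Lemma separable_tree_decomposition (G T : sgraph) (bag : T -> {set G}) r k :
  tree_decomposition bag -> coverable_bags R k r bag -> separable R G r k.
Proof.
move=> tdec cov mu mu0; have [t bal] := tree_decomposition_separator tdec mu0.
by exists (bag t).
Qed.

Lemma balanced_separator_number_leP (G : sgraph) r k :
  (balanced_separator_number R r G <= k)%N <-> separable R G r k.
Proof.
rewrite /balanced_separator_number; case: ex_minnP => k' /asboolP sep min_k'.
split=> [k'k mu mu0|sepk]; last exact/min_k'/asboolP.
have [X [bal cov]] := sep mu mu0; exists X; split=> //.
exact: coverable_mono cov.
Qed.

Lemma tree_partition_width_le (H T : sgraph) (bag : T -> {set H}) k :
  tree_partition bag -> (tp_width bag <= k)%N -> (tree_partition_width H <= k)%N.
Proof.
move=> tp width; rewrite /tree_partition_width; case: ex_minnP => k' _ min_k'.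
by apply: leq_trans width; apply/min_k'/asboolP; exists T, bag.
Qed.

Lemma tree_partition_width_witness (H : sgraph) : exists (T : sgraph) (bag : T -> {set H}),
  tree_partition bag /\ forall t, (#|bag t| <= tree_partition_width H)%N.
Proof.
rewrite /tree_partition_width; case: ex_minnP => k /asboolP[T [bag [tp <-]]] _.
by exists T, bag; split=> // t; exact: (leq_bigmax (F := fun t => #|bag t|)).
Qed.

(** The bound [2 ^ (6 * k * d)] evaluated at the separator size and the degree of the net graph; the
    successor keeps the separator size positive when [k = 0]. *)
Definition net_width (m k : nat) : nat :=
  (2 ^ (6 * (k * 2 ^ (m * 3)).+1 * 2 ^ (m * 3)))%N.

Section Graph.
Variables (G : sgraph) (m r : nat).
Hypotheses (r0 : (0 < r)%N) (dd : doubling_dim_le R m G).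

Let rR0 : 0 < r%:R :> R. Proof. by rewrite ltr0n. Qed.

Lemma net_tree_partition k : separable R G r k ->
  exists (N : {set G}) (phi : G -> net_graph R r N),
  [/\ forall a b, a \in N -> b \in N -> (gdist R a b <= r%:R%:E)%E -> a = b,
      forall v, (gdist R v (val (phi v)) <= r%:R%:E)%E
    & exists (T : sgraph) (bag : T -> {set net_graph R r N}),
      [/\ tree_partition bag, (max_degree T <= (net_width m k).+1)%N
        & (tp_width bag <= net_width m k)%N]].
Proof.
move=> sep; have [N [sparse dense]] := @net_exists R G r%:R (ltW rR0).
have /fin_all_exists[phi phiP] (v : G) :
    exists a : net_graph R r N, (gdist R v (val a) <= r%:R%:E)%E.
  by have [a aN va] := dense v; exists (exist _ a aN).
exists N, phi; split=> //.
apply: tree_partition_of_separators => //.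
- by rewrite expn_gt0.
- exact: net_degree.
- move=> S; have [Y Yk balY] := net_separators dd sparse sep S.
  by exists Y => //; exact: leqW.
Qed.

(** The bags are preimages under [phi]. Vertices within [r] of each other have equal or adjacent net
    points, which gives the spread, and the net points of a bag are centres that cover its
    preimage. *)
Lemma separable_spread_tree_partition k : separable R G r k ->
  exists (T : sgraph) (bag : T -> {set G}),
    [/\ tree_partition bag, has_spread R r bag,
        (max_degree T <= (net_width m k).+1)%N
      & coverable_bags R (net_width m k) r bag].
Proof.
case/net_tree_partition => N [phi [sparse phiP [T [bag [[treeT part edge_bag] degT width]]]]].
have spread : has_spread R r (fun t => phi @^-1: bag t).
  move=> u v uv; have [Euv|/edge_bag] := net_map_near phiP uv.
    by have [t [ut _]] := part (phi u); left; exists t; rewrite !inE -Euv.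
  move=> [[t [ut vt]]|[s [t [st us vt]]]].
    by left; exists t; rewrite !inE.
  by right; exists s, t; rewrite !inE.
exists T, (fun t => phi @^-1: bag t); split=> //.
- split=> //.
  + move=> v; have [t [vt t_uniq]] := part (phi v).
    by exists t; split=> [|t']; rewrite inE //; exact: t_uniq.
  + move=> u v uv; apply: spread.
    have := @gdist_le_walk R G u [:: v]; rewrite /= uv => /(_ isT) /le_trans; apply.
    by rewrite lee_fin ler_nat.
- move=> t; exists [set val a | a in bag t]; split.
    rewrite card_imset; last exact: val_inj.
    by apply: leq_trans width; exact: (leq_bigmax (F := fun t => #|bag t|)).
  apply/subsetP => v; rewrite inE => vt; apply/bigcupP; exists (val (phi v)).
    exact: imset_f.
  by rewrite inE gdist_sym.
Qed.

Lemma separable_quasi_isometric k : separable R G r k -> exists H : wgraph R,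
  [/\ quasi_isometric 3 (3 * r%:R) (unit_weighted R G) H,
      (tree_partition_width H <= net_width m k)%N,
      (max_degree H <= 2 ^ (m * 3))%N
    & forall x y : H, edge x y -> weight x y = 3 * r%:R].
Proof.
case/net_tree_partition => N [phi [sparse phiP [T [bag [tp _ width]]]]].
exists (weighted_net_graph R r N); split=> //.
- exact: net_quasi_isometric phiP.
- exact: tree_partition_width_le tp width.
- exact: net_degree.
Qed.

(** An edge of [G] is mapped to a pair at distance at most [alpha + beta * r <= (alpha + beta) * r].
    Edges of [H] weigh at least [gamma * r], so this many edges join the images, and [r] cancels. *)
Definition hops (alpha beta gamma : R) : nat := (Num.trunc ((alpha + beta) / gamma)).+1.

(** A bag is the preimage of at most [k * Delta.+1 ^ hops alpha beta gamma] vertices of [H]. Two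
    vertices with the same image are within [alpha * beta * r], hence within [2 ^ J * r] for
    [J = trunc (alpha * beta) + 1], and doubling [J] times covers each fibre by [2 ^ (m * J)]
    balls. *)
Lemma quasi_isometric_tree_decomposition (H : wgraph R) k Delta alpha beta gamma :
  0 < gamma -> quasi_isometric alpha (beta * r%:R) (unit_weighted R G) H ->
  (tree_partition_width H <= k)%N -> (max_degree H <= Delta)%N ->
  (forall x y : H, edge x y -> gamma * r%:R <= weight x y) ->
  exists (T : sgraph) (bag : T -> {set G}), tree_decomposition bag /\
    coverable_bags R (k * Delta.+1 ^ hops alpha beta gamma *
      2 ^ (m * (Num.trunc (alpha * beta)).+1)) r bag.
Proof.
move=> gamma0 [alpha1 beta0 [phi [phi_qi _]]] width deg heavy.
set L := hops _ _ _; have alpha0 : 0 < alpha by lra.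
have {}beta0 : 0 <= beta by rewrite -(pmulr_lge0 _ rR0).
have r1 : 1 <= r%:R :> R by rewrite ler1n.
have [T [bag [tp bagk]]] := tree_partition_width_witness H.
exists T; eexists; split.
  apply: (pullback_tree_decomposition (phi := phi) (L := L) tp) => u v uv.
  have [_ phi_uv] := phi_qi u v.
  have guv : (@dist R (unit_weighted R G) u v <= 1%:E)%E.
    by have := @gdist_le_walk R G u [:: v]; rewrite /= uv => /(_ isT).
  have : (dist (phi u) (phi v) < (gamma * r%:R * L%:R)%:E)%E.
    apply: le_lt_trans phi_uv _.
    apply: (@le_lt_trans _ _ (alpha%:E * 1%:E + (beta * r%:R)%:E)%E).
      by rewrite leeD2r // lee_pmul2l // ?lte_fin.
    rewrite -EFinM -EFinD lte_fin mulr1.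
    have : (alpha + beta) / gamma < L%:R by exact: truncnS_gt.
    rewrite ltr_pdivrMr // => h.
    have : (alpha + beta) * r%:R < L%:R * gamma * r%:R by rewrite ltr_pM2r.
    have : alpha * 1 <= alpha * r%:R by rewrite ler_pM2l.
    by lra.
  case/dist_lt_walk => p [pP lastp short]; apply/reachP; exists p; split=> //.
  have := le_lt_trans (walk_length_ge heavy pP) short.
  by rewrite ltr_pM2l ?mulr_gt0 // ltr_nat => /ltnW.
move=> t; set J := (Num.trunc _).+1.
pose W := \bigcup_(y in bag t) reach L y.
apply: (@coverable_mono _ _ _ _ _ _ (\bigcup_(w in W) phi @^-1: [set w])
  _ (leqnn _) (lexx _)); last first.
  apply: coverable_bigcup.
    apply: leq_trans (leq_card_bigcup _ _) _.
    apply: (@leq_trans (\sum_(y in bag t) Delta.+1 ^ L)%N).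
      apply: leq_sum => y _; apply: leq_trans (card_reach _ _) _.
      by rewrite leq_exp2r.
    by rewrite sum_nat_const leq_mul2r (leq_trans (bagk t)) ?orbT.
  move=> w _; have [->|[u uw]] := set_0Vmem (phi @^-1: [set w]).
    exists finset.set0; rewrite cards0; split=> //; exact: sub0set.
  apply: coverable_mono (leqnn _) (lexx _) _ (coverable_ball_iter dd J u (ltW rR0)).
  apply/subsetP => v; move: uw; rewrite !inE => /eqP <- /eqP Ev.
  have [+ _] := phi_qi u v; rewrite Ev.
  have : (dist (phi u) (phi u) <= 0)%E by apply: ereal_inf_lbound; exists [::].
  move=> refl0 /le_trans/(_ refl0); rewrite -/(gdist R u v).
  case: (gdist R u v) => [x||] //.
    rewrite -EFinM -EFinB !lee_fin subr_le0 mulrC ler_pdivrMr // => /le_trans; apply.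
    rewrite mulrAC ler_wpM2r ?(ltW rR0) // mulrC -natrX.
    apply: ltW (lt_le_trans (truncnS_gt _) _); rewrite ler_nat.
    exact/ltnW/ltn_expl.
    by rewrite gt0_muley ?lte_fin ?invr_gt0.
  by rewrite leNye.
apply/subsetP => v; rewrite inE => /exists_inP[y yt vy].
apply/bigcupP; exists (phi v); last by rewrite !inE.
by apply/bigcupP; exists y.
Qed.

End Graph.

(** Choosing [f] before [C] and [r] expresses that the new constants depend only on [m] and the old
    ones. *)
Definition implies_uniformly (i j : condition) : Prop :=
  exists f : nat -> constants R i -> constants R j,
  forall (m : nat) (C : graph_class),
    (forall G : sgraph, C G -> doubling_dim_le R m G) ->
  forall r : nat, (0 < r)%N ->
  forall c : constants R i, holds_with R C r i c -> holds_with R C r j (f m c).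

Lemma implies_uniformly_trans i j k :
  implies_uniformly i j -> implies_uniformly j k -> implies_uniformly i k.
Proof.
move=> [f fP] [g gP]; exists (fun m c => g m (f m c)) => m C dd r r0 c ci.
by apply: gP => //; exact: fP.
Qed.

Lemma partition_decomposition :
  implies_uniformly SpreadTreePartition CoverableTreeDecomposition.
Proof.
exists (fun _ c => c.2.+1 * c.1)%N => m C dd r r0 [k Delta] /= tps G CG.
have [T [bag [tp _ degT cov]]] := tps G CG.
exists T, (fun t => \bigcup_(s in closed_nbh t) bag s); split.
  exact: tree_decomposition_of_partition.
move=> t; apply: coverable_bigcup => [|s _]; last exact: cov.
exact: leq_trans (card_closed_nbh t) _.
Qed.

Lemma decomposition_separator :
  implies_uniformly CoverableTreeDecomposition BoundedSeparatorNumber.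
Proof.
exists (fun _ k => k) => m C dd r r0 k /= tds G CG.
have [T [bag [tdec cov]]] := tds G CG.
exact/balanced_separator_number_leP/(separable_tree_decomposition tdec cov).
Qed.

Lemma separator_partition :
  implies_uniformly BoundedSeparatorNumber SpreadTreePartition.
Proof.
exists (fun m k => (net_width m k, (net_width m k).+1)) => m C dd r r0 k /= seps G CG.
by apply: separable_spread_tree_partition => //; [exact: dd|
  exact/balanced_separator_number_leP/seps].
Qed.

Lemma separator_quasi_isometric :
  implies_uniformly BoundedSeparatorNumber QuasiIsometric_3_3r.
Proof.
exists (fun m k => (net_width m k, 2 ^ (m * 3)))%N => m C dd r r0 k /= seps G CG.
by apply: separable_quasi_isometric => //; [exact: dd|
  exact/balanced_separator_number_leP/seps].
Qed.

Lemma quasi_isometric_weaken :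
  implies_uniformly QuasiIsometric_3_3r QuasiIsometricLinear.
Proof.
(* The special case [alpha = beta = gamma = 3]. *)
exists (fun _ c => (c, (3, 3, 3))) => m C dd r r0 [k Delta] /= qi; split; first by split; lra.
move=> G CG; have [H [qiH width deg wH]] := qi G CG; exists H; split=> // x y /wH ->.
exact: lexx.
Qed.

Lemma quasi_isometric_decomposition :
  implies_uniformly QuasiIsometricLinear CoverableTreeDecomposition.
Proof.
exists (fun m c => c.1.1 * c.1.2.+1 ^ hops c.2.1.1 c.2.1.2 c.2.2 *
  2 ^ (m * (Num.trunc (c.2.1.1 * c.2.1.2)).+1))%N.
move=> m C dd r r0 [[k Delta] [[alpha beta] gamma]] /= [[_ _ gamma0] qi] G CG.
have [H [qiH width deg heavy]] := qi G CG.
exact: (quasi_isometric_tree_decomposition r0 (dd G CG) gamma0 qiH width deg heavy).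
Qed.

(** All implications are routed through the separator number. *)
Lemma conditions_equivalent i j : implies_uniformly i j.
Proof.
have to_sep : implies_uniformly i BoundedSeparatorNumber.
  have dec := decomposition_separator.
  have lin := implies_uniformly_trans quasi_isometric_decomposition dec.
  case: i.
  - exact: implies_uniformly_trans partition_decomposition dec.
  - exact: dec.
  - by exists (fun _ c => c).
  - exact: implies_uniformly_trans quasi_isometric_weaken lin.
  - exact: lin.
apply: implies_uniformly_trans to_sep _; case: j.
- exact: separator_partition.
- exact: implies_uniformly_trans separator_partition partition_decomposition.
- by exists (fun _ c => c).
- exact: separator_quasi_isometric.
- exact: implies_uniformly_trans separator_quasi_isometric quasi_isometric_weaken.
Qed.

End Conditions.

Theorem theorem1p2 (R : realType) :
  (forall (m : nat) (C : graph_class),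
     (forall G : sgraph, C G -> doubling_dim_le R m G) ->
   forall r : nat, (0 < r)%N ->
     [<-> exists k1 Delta1 : nat, spread_tree_partitions R C r k1 Delta1;
          exists k2 : nat, coverable_tree_decompositions R C r k2;
          exists k3 : nat, bounded_separator_number R C r k3;
          exists k4 Delta4 : nat, quasi_isometric_3_3r R C r k4 Delta4;
          exists (k5 Delta5 : nat) (alpha beta gamma : R),
            quasi_isometric_linear C r k5 Delta5 alpha beta gamma])
  /\
  (forall i j : condition,
     exists f : nat -> constants R i -> constants R j,
     forall (m : nat) (C : graph_class),
       (forall G : sgraph, C G -> doubling_dim_le R m G) ->
     forall r : nat, (0 < r)%N ->
     forall c : constants R i,
       holds_with R C r i c -> holds_with R C r j (f m c)).
Proof.
split; last exact: conditions_equivalent.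
move=> m C dd r r0.
(* The equivalence for fixed [C] and [r] follows from the uniform version by forgetting how the
   constants are computed. *)
have imp i j (c : constants R i) : holds_with R C r i c ->
    exists c' : constants R j, holds_with R C r j c'.
  by have [f fP] := conditions_equivalent R i j; exists (f m c); exact: fP.
tfae.
- move=> [k [D h]].
  by have [c hc] := imp SpreadTreePartition CoverableTreeDecomposition (k, D) h; exists c.
- move=> [k h].
  by have [c hc] := imp CoverableTreeDecomposition BoundedSeparatorNumber k h; exists c.
- move=> [k h]; have [[k' D'] hc] := imp BoundedSeparatorNumber QuasiIsometric_3_3r k h.
  by exists k', D'.
- move=> [k [D h]].
  have [[[k' D'] [[a b] c]] hc] := imp QuasiIsometric_3_3r QuasiIsometricLinear (k, D) h.
  by exists k', D', a, b, c.
- move=> [k [D [a [b [c h]]]]].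
  have [[k' D'] hc] := imp QuasiIsometricLinear SpreadTreePartition (k, D, (a, b, c)) h.
  by exists k', D'.
Qed.
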